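(* Let $X=\bigoplus_{i\in I}X_i$ be a topological sum (disjoint union) of $\sigma$-compact Tychonoff spaces $X_i$, $i\in I$. Then $(B_1(X),\tau_{UC})$ is a strong Choquet space.
   Context: $\omega$ is the set of non-negative integers. $B_1(X)$ is the set of all functions $f:X\to\mathbb R$ that are pointwise limits of a sequence of continuous functions from $X$ to $\mathbb R$ (Baire 1 functions). $\tau_{UC}$ is the topology of uniform convergence on compact sets: a base of neighbourhoods of $f$ is given by the sets $W(f,K,\varepsilon)=\{g:\ |f(x)-g(x)|<\varepsilon \text{ for all } x\in K\}$, where $K\subset X$ is nonempty compact and $\varepsilon>0$. Strong Choquet game on a topological space $Z$: player $\beta$ starts by choosing a pair $(x_0,U_0)$ with $U_0\subset Z$ open and $x_0\in U_0$; player $\alpha$ answers with an open set $V_0\subset U_0$ with $x_0\in V_0$. In the $n$th move ($n\ge 1$), $\beta$ chooses $(x_n,U_n)$ with $U_n$ open, $x_n\in U_n\subset V_{n-1}$, and $\alpha$ answers with an open set $V_n\subset U_n$ with $x_n\in V_n$. Player $\alpha$ wins the play if $\bigcap_{n\in\omega}V_n\neq\emptyset$; otherwise $\beta$ wins. $Z$ is a strong Choquet space if $\alpha$ has a winning strategy in this game. *)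

(* Defs.v *)
From HB Require Import structures.
From mathcomp Require Import all_boot all_order all_algebra.
From mathcomp Require Import all_classical all_reals all_analysis.

Set Implicit Arguments.
Unset Strict Implicit.
Unset Printing Implicit Defensive.

Import Order.TTheory GRing.Theory Num.Theory.
Import numFieldNormedType.Exports.

Local Open Scope classical_set_scope.
Local Open Scope ring_scope.

(* [uniform_separator], on which [completely_regular_space] rests, is shown in
   the library (lemma [uniform_separatorP]) to be separation by a continuous
   function into [0, 1]. *)
Definition tychonoff_space (X : topologicalType) : Prop :=
  completely_regular_space X /\ hausdorff_space X.

Definition sigma_compact (X : topologicalType) : Prop :=
  exists K : nat -> set X,
    (forall n, compact (K n)) /\ \bigcup_n K n = [set: X].

Section Baire1.
Context (X : topologicalType) (R : realType).

(* The ambient topology is uniform convergence on compact sets.  It must not be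
   replaced by {compact-open, X -> R}, which agrees with it only on continuous
   functions. *)
Definition baire1 : set {family compact, X -> R} :=
  [set f | exists u : nat -> X -> R,
     (forall n, continuous (u n)) /\
     (forall x, u n x @[n --> \oo] --> f x)].

(* [set_type baire1] carries the subspace topology. *)
Definition baire1_space : topologicalType := set_type baire1.

(* The sets W(f, K, e) form a base of neighbourhoods.  Allowing K = set0 only
   adds the whole space, and makes the lemma hold for empty X too. *)
Lemma baire1_space_nbhsP (f : baire1_space) (P : set baire1_space) :
  nbhs f P <->
  exists (K : set X) (e : R), [/\ compact K, 0 < e &
    [set g : baire1_space | forall x, K x -> `|val f x - val g x| < e]
      `<=` P].
Proof.
split=> [[_ [[Q oQ <-] Qf QP]]|[K [e [cK e0 KP]]]].
  pose G : set_system (X -> R) := filter_from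
    [set Ke : set X * R | compact Ke.1 /\ 0 < Ke.2]
    (fun Ke => [set g : X -> R | forall x, Ke.1 x -> `|val f x - g x| < Ke.2]).
  have GF : Filter G.
    apply: filter_from_filter.
      by exists (set0, 1); split; [exact: compact0|exact: ltr01].
    move=> [K e] [L d] /= [cK e0] [cL d0]; exists (K `|` L, Num.min e d) => /=.
      by split; [exact: compactU|rewrite lt_min e0].
    move=> g /= h; split=> x Kx.
      by have := h x (or_introl Kx); rewrite lt_min => /andP[].
    by have := h x (or_intror Kx); rewrite lt_min => /andP[].
  have Gf : {family compact, G --> val f}.
    apply/fam_cvgP => A cA B /uniform_nbhs[E [entE EB]].
    move: entE; rewrite -entourage_ballE => -[e /= e0 eE].
    exists (A, e) => //= g h; apply: EB => y Ay.
    by apply: eE => /=; exact: h.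
  have : nbhs (val f : {family compact, X -> R}) Q by exact: open_nbhs_nbhs.
  move=> /Gf[[K e] /= [cK e0] KQ]; exists K, e; split=> // g h.
  by apply: QP; exact: KQ.
apply: (filterS KP).
have h : nbhs (val f : {family compact, X -> R})
    [set g : X -> R | forall x, K x -> `|val f x - g x| < e].
  apply: (fam_nbhs (E := [set xy : R * R | `|xy.1 - xy.2| < e])) cK.
  by rewrite -entourage_ballE; exists e.
exact: (@initial_continuous _ _
  (set_val : set_type baire1 -> {family compact, X -> R}) f _ h).
Qed.

End Baire1.

Section StrongChoquet.
Context (Z : topologicalType).

(* In round n, beta plays (x n, U n) and alpha answers V n. *)
Definition beta_legal (x : nat -> Z) (U V : nat -> set Z) (n : nat) : Prop :=
  [/\ open (U n), U n (x n) & if n is m.+1 then U n `<=` V m else True].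

Definition alpha_legal (x : nat -> Z) (U V : nat -> set Z) (n : nat) : Prop :=
  [/\ open (V n), V n (x n) & V n `<=` U n].

(* Alpha's answer to the list of beta's moves so far; alpha's own earlier moves
   are determined by those and by the strategy. *)
Definition alpha_strategy : Type := seq (Z * set Z) -> set Z.

Definition answer (s : alpha_strategy) (x : nat -> Z) (U : nat -> set Z)
    (n : nat) : set Z :=
  s (mkseq (fun k => (x k, U k)) n.+1).

(* The strategy must answer legally as long as beta has played legally, also in
   finite plays, and must win every infinite play in which beta is legal. *)
Definition alpha_winning (s : alpha_strategy) : Prop :=
  forall (x : nat -> Z) (U : nat -> set Z), let V := answer s x U in
    (forall n, (forall k, (k <= n)%N -> beta_legal x U V k) ->
       alpha_legal x U V n) /\
    ((forall n, beta_legal x U V n) -> \bigcap_n V n !=set0).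

Definition strong_choquet : Prop := exists s : alpha_strategy, alpha_winning s.

End StrongChoquet.

(* Main.v *)
Require Import Defs.
From mathcomp Require Import all_boot all_order all_algebra.
From mathcomp Require Import all_classical all_reals all_analysis.
From mathcomp Require Import lra.

(** Why alpha wins.  To a move (f_n, U_n) of beta, with W(f_n, K_n, e_n)
contained in U_n, alpha answers the interior of W(f_n, D_n, d_n), where d_n is
at most e_n / 2 and 2^-n, and D_n enlarges K_n as follows.  A compact subset of
the sum meets only finitely many summands; for each summand X_i met by one of
K_0, ..., K_n, alpha adds to K_n the member of index n + 1 of an
increasing compact exhaustion of X_i.

Since the answers are nested, all later f_m stay d_n-close to f_n on D_n.  Hence
f_n converges on every summand that is met at some time, uniformly on each
member of its exhaustion.  Let F be this limit on those summands and 0 on all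
the others.  Then F stays within d_n < e_n of f_n on K_n, so F lies in every
U_n, hence in every answer, provided that it is a Baire 1 function.

On a sum, being Baire 1 can be checked summand by summand, so what remains is
[baire1_exhaustion]: on a completely regular space X with an increasing compact
cover K_n, a function F with |F - f_n| <= 2^-n on K_n, each f_n Baire 1, is
Baire 1.  The uniform estimates hold on K_n only, so the usual summation of
truncated differences fails, and a cut-off that equals 1 on K_n and tends to 0
off K_n need not exist, K_n being in general no G_delta set.  But given
continuous u_k -> f_n and v_k -> f_(n+1), only the part e_k of u_k - v_k in
excess of 2 / 2^n has to be added to v_k on K_n, and its limit e vanishes on
K_n.  The set where e is nonzero is an F_sigma set disjoint from K_n, and
cut-offs adapted to it turn e_k into a null sequence without changing it on K_n
([cutoff_null], [approximation_within]).  Thus f_(n+1) has continuous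
approximants that are 2 / 2^n-close on K_n to those of f_n.  Iterating, the
diagonal of the array of approximants so obtained converges to F. *)

Set Implicit Arguments.
Unset Strict Implicit.
Unset Printing Implicit Defensive.

Import Order.TTheory GRing.Theory Num.Theory.
Import numFieldNormedType.Exports.

Local Open Scope classical_set_scope.
Local Open Scope ring_scope.

(** * Compactness and separation *)

(** The sets A such that K \ A satisfies P form a filter; if P failed for K
this filter would be proper, and a cluster point in K would contradict P being
local. *)
Lemma compact_local_ind {X : topologicalType} (K : set X) (P : set X -> Prop) :
  compact K -> P set0 -> (forall A B, A `<=` B -> P B -> P A) ->
  (forall A B, P A -> P B -> P (A `|` B)) ->
  (forall x, K x -> exists2 U, nbhs x U & P U) -> P K.
Proof.
move=> cK P0 Psub PU Ploc; apply: contrapT => nPK.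
pose F : set_system X := [set A | P (K `\` A)].
have FF : ProperFilter F.
  apply: Build_ProperFilter_ex.
    move=> A FA; apply/set0P/eqP => A0.
    by apply: nPK; move: FA; rewrite /F/= A0 setD0.
  split.
  - by rewrite /F/= setDT.
  - by move=> A B FA FB; rewrite /F/= setDIr; exact: PU.
  - by move=> A B AB; apply: Psub; exact: setDS.
have FK : F K by rewrite /F/= setDv.
have [x [Kx clx]] := cK F FF FK.
have [U Ux PUU] := Ploc x Kx.
have FU : F (~` U) by apply: Psub PUU; rewrite setDE setCK; exact: subIsetr.
by have [y []] := clx _ _ FU Ux.
Qed.

Section CompletelyRegular.
Context {R : realType} {X : topologicalType}.
Hypothesis crX : completely_regular_space X.

(** Functions vanishing on two sets, and equal to 1 on B, have a product that
vanishes on the union: the separation of points from B extends to compact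
sets. *)
Lemma completely_regular_compact_separator (K B : set X) :
  compact K -> closed B -> K `&` B = set0 ->
  exists f : X -> R, [/\ continuous f, forall x, 0 <= f x <= 1,
    forall x, K x -> f x = 0 & forall x, B x -> f x = 1].
Proof.
move=> cK cB KB0.
apply: (compact_local_ind (P := fun A => exists f : X -> R, [/\ continuous f,
  forall x, 0 <= f x <= 1, forall x, A x -> f x = 0 &
  forall x, B x -> f x = 1]) cK).
- by exists (cst 1); split=> // x; [exact: cvg_cst|rewrite ler01 lexx].
- by move=> A A' AA' [f [cf f01 f0 f1]]; exists f; split=> // x /AA'; exact: f0.
- move=> A A' [f [cf f01 f0 f1]] [g [cg g01 g0 g1]].
  exists (fun x => f x * g x); split.
  + by move=> x; apply: cvgM; [exact: cf|exact: cg].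
  + move=> x; have /andP[? ?] := f01 x; have /andP[? ?] := g01 x.
    by rewrite mulr_ge0//= mulr_ile1.
  + by move=> x [/f0->|/g0->]; rewrite (mul0r, mulr0).
  + by move=> x Bx; rewrite f1// g1// mulr1.
- move=> a Ka.
  have nBa : ~ B a by move=> Ba; have : (K `&` B) a by []; rewrite KB0.
  have [f [cf f01 fa fB]] := (uniform_separatorP (R := R) _ _).1 (crX cB nBa).
  exists (f @^-1` [set y | y < 2^-1]).
    apply: cf; have -> : f a = 0 by apply: fa; exists a.
    by apply: open_nbhs_nbhs; split; [exact: open_lt|rewrite /= invr_gt0].
  (* t |-> (2t - 1 + |2t - 1|) / 2 is max(2t - 1, 0): it kills [0, 1/2] and
     fixes 1. *)
  exists (fun x => (2 * f x - 1 + `|2 * f x - 1|) / 2); split.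
  + have c1 : continuous (fun x => 2 * f x - 1).
      move=> x; apply: cvgB; last exact: cvg_cst.
      by apply: cvgMl_tmp; exact: cf.
    move=> x; apply: cvgMr_tmp; apply: cvgD; first exact: c1.
    by apply: cvg_norm; exact: c1.
  + move=> x; have := f01 (f x); rewrite /= in_itv/= => /(_ _)/andP[].
      by exists x.
    by move=> ? ?; have [?|?] := ger0P (2 * f x - 1); apply/andP; split; lra.
  + by move=> x /= fx; rewrite ler0_norm; lra.
  + move=> x Bx; have -> : f x = 1 by apply: fB; exists x.
    by rewrite ger0_norm; lra.
Qed.

(** The set where l is nonzero is the increasing union of the closed sets G j
on which |e k| >= 1 / (j + 1) for all k >= j, and each of them is disjoint
from K.  Multiply e k by a function that is 1 on K and 0 on G k: where l is
nonzero the product is eventually 0, elsewhere it is bounded by |e k|. *)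
Lemma cutoff_null (K : set X) (e : nat -> X -> R) (l : X -> R) :
  compact K -> (forall k, continuous (e k)) ->
  (forall x, e k x @[k --> \oo] --> l x) -> (forall x, K x -> l x = 0) ->
  exists c : nat -> X -> R, [/\ forall k, continuous (c k),
    forall k x, K x -> c k x = e k x &
    forall x, c k x @[k --> \oo] --> (0 : R)].
Proof.
move=> cK ce el l0.
pose G j :=
  \bigcap_(k in [set k | (j <= k)%N]) [set x | j.+1%:R^-1 <= `|e k x|].
have clG j : closed (G j).
  apply: closed_bigI => k _.
  apply: (@closed_comp _ _ (fun x => `|e k x|) [set y | j.+1%:R^-1 <= y]).
    by move=> x _; apply: cvg_norm; exact: ce.
  exact: closed_ge.
have GK j : K `&` G j = set0.
  rewrite -subset0 => x [Kx Gx].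
  have [|N _ hN] := cvgr_norm_lt _ (el x) j.+1%:R^-1.
    by rewrite l0// normr0 invr_gt0.
  have := hN (maxn N j) (leq_maxl _ _).
  by rewrite ltNge => /negP; apply; apply: Gx; rewrite /= leq_maxr.
have [phi phiP] := choice (fun j =>
  completely_regular_compact_separator cK (clG j) (GK j)).
exists (fun k x => (1 - phi k x) * e k x); split.
- move=> k x; have [cphi _ _ _] := phiP k.
  apply: cvgM; last exact: ce.
  by apply: cvgB; [exact: cvg_cst|exact: cphi].
- by move=> k x Kx; have [_ _ -> //] := phiP k; rewrite subr0 mul1r.
- move=> x; have [lx0|lx0] := eqVneq (l x) 0.
    apply/cvgrPdist_lt => d d0.
    have := cvgr_norm_lt _ (el x) d; rewrite lx0 normr0 => /(_ _ d0).
    apply: filterS => k; apply: le_lt_trans.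
    have [_ /(_ x)/andP[p0 p1] _ _] := phiP k.
    rewrite sub0r normrN normrM ler_piMl// ger0_norm; lra.
  have [m _ hm] : \forall j \near \oo, (2 / `|l x|) < j%:R :> R.
    exact: nbhs_infty_gtr.
  have l20 : 0 < `|l x| by rewrite normr_gt0.
  have [|N _ hN] := cvgr_norm_gt _ (el x) (`|l x| / 2); first by lra.
  have Gx j : (maxn m N <= j)%N -> G j x.
    rewrite geq_max => /andP[mj Nj] k /= jk.
    apply: (le_trans _ (ltW (hN k (leq_trans Nj jk)))).
    rewrite -[leRHS]invrK invf_div lef_pV2 ?posrE ?divr_gt0 //.
    by apply/ltW/hm => /=; exact: (leq_trans mj).
  apply: cvg_near_cst; exists (maxn m N) => // k /= mk.
  by have [_ _ _ ->] := phiP k; [rewrite subrr mul0r|exact: Gx].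
Qed.

(** Approximants of g can be corrected on K so as to follow those of f as
closely as g follows f there.  The correction is the excess of u k - v k over
[-d, d], cut off to a null sequence. *)
Lemma approximation_within (K : set X) (d : R) (f g : X -> R)
    (u v : nat -> X -> R) :
  compact K -> 0 <= d -> (forall x, K x -> `|f x - g x| <= d) ->
  (forall k, continuous (u k)) -> (forall x, u k x @[k --> \oo] --> f x) ->
  (forall k, continuous (v k)) -> (forall x, v k x @[k --> \oo] --> g x) ->
  exists w : nat -> X -> R, [/\ forall k, continuous (w k),
    forall x, w k x @[k --> \oo] --> g x &
    forall k x, K x -> `|u k x - w k x| <= d].
Proof.
move=> cK d0 fg cu uf cv vg.
(* (|y + d| - |y - d|) / 2 is y truncated to [-d, d]. *)
pose ex (y : R) := y - (`|y + d| - `|y - d|) / 2.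
have cex : continuous ex.
  move=> y; apply: cvgB; first exact: cvg_id.
  apply: cvgMr_tmp; apply: cvgB; apply: cvg_norm.
    by apply: cvgD; [exact: cvg_id|exact: cvg_cst].
  by apply: cvgB; [exact: cvg_id|exact: cvg_cst].
have exd y : `|y - ex y| <= d.
  rewrite /ex subKr ler_norml.
  by have [?|?] := ger0P (y + d); have [?|?] := ger0P (y - d);
    apply/andP; split; lra.
have ex0 y : `|y| <= d -> ex y = 0.
  rewrite /ex ler_norml => /andP[? ?].
  by rewrite ger0_norm ?ler0_norm; lra.
have [c [cc cK' c0]] : exists c : nat -> X -> R, [/\
    forall k, continuous (c k),
    forall k x, K x -> c k x = ex (u k x - v k x) &
    forall x, c k x @[k --> \oo] --> (0 : R)].
  apply: (cutoff_null (e := fun k x => ex (u k x - v k x))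
                      (l := fun x => ex (f x - g x)) cK).
  - move=> k x; apply: (@continuous_comp _ _ _ (fun x => u k x - v k x) ex).
      by apply: cvgB; [exact: cu|exact: cv].
    exact: cex.
  - move=> x.
    apply: (@continuous_cvg _ R R _ _ (fun k => u k x - v k x) ex (f x - g x)).
      exact: cex.
    exact: cvgB.
  - by move=> x Kx; apply/ex0/fg.
exists (fun k x => v k x + c k x); split.
- by move=> k x; apply: cvgD; [exact: cv|exact: cc].
- by move=> x; rewrite -[X in _ --> X]addr0; exact: cvgD.
- by move=> k x Kx; rewrite cK'// opprD addrA; exact: exd.
Qed.

End CompletelyRegular.

(** * Baire 1 functions and compact exhaustions *)

(** The approximants v n of f n are chosen inductively so that v n.+1 follows
v n on K n; the diagonal v k k then stays within 4 / 2^n of v n k on K n for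
k >= n. *)
Lemma baire1_exhaustion {R : realType} {X : topologicalType}
    (K : nat -> set X) (f : nat -> X -> R) (F : X -> R) :
  completely_regular_space X ->
  (forall n, compact (K n)) -> (forall n, K n `<=` K n.+1) ->
  \bigcup_n K n = [set: X] -> (forall n, baire1 (f n)) ->
  (forall n x, K n x -> `|F x - f n x| <= 2^-1 ^+ n) -> baire1 F.
Proof.
move=> crX cK KS Kcover bf Ff.
pose approximates n (v : nat -> X -> R) :=
  (forall k, continuous (v k)) /\ forall x, v k x @[k --> \oo] --> f n x.
have r0 n : 0 <= 2^-1 ^+ n :> R by rewrite exprn_ge0// invr_ge0.
have step (p : nat * (nat -> X -> R)) : exists w : nat -> X -> R,
    approximates p.1 p.2 -> approximates p.1.+1 w /\
    forall k x, K p.1 x -> `|p.2 k x - w k x| <= 2 * 2^-1 ^+ p.1.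
  case: p => n u /=.
  have [[cu uf]|nu] := pselect (approximates n u); last by exists u.
  have [v [cv vf]] := bf n.+1.
  have ffS x : K n x -> `|f n x - f n.+1 x| <= 2 * 2^-1 ^+ n.
    move=> Kx; have := Ff _ _ Kx; have := Ff _ _ (KS _ _ Kx).
    rewrite exprS; have := r0 n; set r := 2^-1 ^+ n => ? ? ?.
    have := ler_distD (F x) (f n x) (f n.+1 x).
    by rewrite (distrC (f n x) (F x)); lra.
  have [|w [cw wf uw]] := approximation_within crX (cK n) _ ffS cu uf cv vf.
    by rewrite mulr_ge0.
  by exists w.
have [S SP] := choice step.
have [u0 [cu0 u0f]] := bf 0%N.
pose v := fix v n := if n is m.+1 then S (m, v m) else u0.
have vP n : approximates n (v n).
  by elim: n => [|n IHn] //=; have [] := SP (n, v n) IHn.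
have vS n k x : K n x -> `|v n k x - v n.+1 k x| <= 2 * 2^-1 ^+ n.
  by have [_] := SP (n, v n) (vP n); apply.
have KD n m : K n `<=` K (n + m)%N.
  elim: m => [|m IHm]; first by rewrite addn0.
  by rewrite addnS; exact: (subset_trans IHm).
(* The increments 2 / 2^j telescope against 4 / 2^j - 4 / 2^(j+1). *)
have vD n m k x : K n x ->
    `|v n k x - v (n + m)%N k x| <= 4 * 2^-1 ^+ n - 4 * 2^-1 ^+ (n + m).
  move=> Kx; elim: m => [|m IHm]; first by rewrite addn0 !subrr normr0.
  have := vS (n + m)%N k x (KD _ _ _ Kx).
  have := ler_distD (v (n + m)%N k x) (v n k x) (v (n + m.+1)%N k x).
  by rewrite addnS exprS; lra.
exists (fun k => v k k); split=> [k|x]; first by have [] := vP k.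
have [N _ KNx] : (\bigcup_n K n) x by rewrite Kcover.
apply/cvgrPdist_lt => e e0.
have r_cvg : (2^-1 : R) ^+ n @[n --> \oo] --> (0 : R).
  by apply: cvg_expr; rewrite ger0_norm ?invr_ge0// invf_lt1// ltr1n.
have [|M _ rM] := cvgr_norm_lt _ r_cvg (e / 10).
  by rewrite normr0 divr_gt0.
pose n := maxn N M.
have Knx : K n x by rewrite /n maxnE; exact: KD.
have := rM n (leq_maxr _ _); rewrite ger0_norm// => rn.
have [_ /(_ x)] := vP n => /cvgrPdist_lt/(_ (e / 10)) [|L _ hL].
  by rewrite divr_gt0.
exists (maxn n L) => // k /=; rewrite geq_max => /andP[nk Lk].
have := hL k Lk; have := Ff n x Knx; have := vD n (k - n)%N k x Knx.
rewrite subnKC//.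
have := r0 k; have := ler_distD (f n x) (F x) (v k k x).
have := ler_distD (v n k x) (f n x) (v k k x).
lra.
Qed.

(** * Topological sums *)

Section TopologicalSum.
Context {I : choiceType} {X : I -> topologicalType}.

Lemma baire1_sigT {R : realType} (f : {i & X i} -> R) :
  (forall i, baire1 (f \o existT X i)) -> baire1 f.
Proof.
move=> bf; pose u i := projT1 (cid (bf i)).
exists (fun n p => u (projT1 p) n (projT2 p)); split.
  move=> n; apply: (@sigT_continuous _ _ _ (fun i => u i n)) => i.
  by rewrite /u; case: cid => /= v [].
by move=> [i x]; rewrite /u /=; case: cid => /= v [_]; apply.
Qed.

Lemma baire1_existT {R : realType} (f : {i & X i} -> R) (i : I) :
  baire1 f -> baire1 (f \o existT X i).
Proof.
move=> [u [cu uf]]; exists (fun n => u n \o existT X i); split.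
  move=> n x; apply: continuous_comp; first exact: existT_continuous.
  exact: cu.
by move=> x; exact: uf.
Qed.

(** Each summand is open and projects to a single index. *)
Lemma compact_sigT_finite (K : set {i & X i}) :
  compact K -> finite_set (@projT1 I X @` K).
Proof.
move=> cK.
apply: (compact_local_ind (P := fun A => finite_set (@projT1 I X @` A)) cK).
- by rewrite image_set0.
- by move=> A B AB; apply: sub_finite_set; exact: image_subset.
- by move=> A B fA fB; rewrite image_setU finite_setU.
- move=> [i x] _; exists (existT X i @` setT).
    by apply: existT_nbhs; exact: filterT.
  apply: (@sub_finite_set _ _ [set i]); last exact: finite_set1.
  by move=> _ [_ [y _ <-] <-].
Qed.

Lemma compact_sigT_bigcup (J : set I) (A : forall i, set (X i)) :
  finite_set J -> (forall i, compact (A i)) ->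
  compact (\bigcup_(i in J) existT X i @` A i).
Proof.
move=> fJ cA; rewrite -bigsetU_fset_set//; apply: bigsetU_compact => i _.
apply: continuous_compact; last exact: cA.
exact/continuous_subspaceT/existT_continuous.
Qed.

End TopologicalSum.

Lemma sigma_compact_exhaustion (X : topologicalType) : sigma_compact X ->
  exists C : nat -> set X, [/\ forall n, compact (C n),
    forall m n, (m <= n)%N -> C m `<=` C n & \bigcup_n C n = [set: X]].
Proof.
move=> [K [cK KX]]; exists (fun n => \big[setU/set0]_(k < n) K k); split.
- by move=> n; exact: bigsetU_compact.
- by move=> m n mn; exact: subset_bigsetU.
- rewrite -subTset -KX => x [n _ Kx]; exists n.+1 => //.
  by rewrite -bigcup_mkord; exists n => /=.
Qed.

(** The limit of a play: J n stands for the summands met up to round n, and D n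
for the compact set on which round n controls all later functions.  Summands
outside of every J n are not controlled at all, but there F may be chosen
freely. *)
Lemma baire1_sigT_limit {R : realType} {I : choiceType}
    {X : I -> topologicalType} (C : forall i, nat -> set (X i))
    (f : nat -> {i & X i} -> R) (J : nat -> set I) (D : nat -> set {i & X i})
    (d : nat -> R) :
  (forall i, completely_regular_space (X i)) ->
  (forall i n, compact (C i n)) ->
  (forall i m n, (m <= n)%N -> C i m `<=` C i n) ->
  (forall i, \bigcup_n C i n = [set: X i]) ->
  (forall n, baire1 (f n)) ->
  (forall m n, (m <= n)%N -> J m `<=` J n) ->
  (forall n p, D n p -> J n (projT1 p)) ->
  (forall n i y, J n i -> C i n y -> D n (existT X i y)) ->
  (forall n, d n <= 2^-1 ^+ n) ->
  (forall m n p, (m <= n)%N -> D m p -> `|f m p - f n p| < d m) ->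
  exists F : {i & X i} -> R,
    baire1 F /\ forall n p, D n p -> `|f n p - F p| <= d n.
Proof.
move=> crX cC CS Ccover bf JS DJ CD d_le fD.
have fcvg p : (exists n, J n (projT1 p)) -> cvg (f n p @[n --> \oo]).
  case: p => i y [n0 /= Jn0].
  have [N _ CN] : (\bigcup_n C i n) y by rewrite Ccover.
  apply/cauchy_cvgP/cauchy_exP => e e0.
  have r_cvg : (2^-1 : R) ^+ n @[n --> \oo] --> (0 : R).
    by apply: cvg_expr; rewrite ger0_norm ?invr_ge0// invf_lt1// ltr1n.
  have [|M _ rM] := cvgr_norm_lt _ r_cvg e; first by rewrite normr0.
  pose n := maxn (maxn n0 N) M.
  have Dn : D n (existT X i y).
    apply: CD.
      by apply: JS Jn0; rewrite /n -maxnA leq_maxl.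
    by apply: CS CN; rewrite /n (maxnC n0) -maxnA leq_maxl.
  exists (f n (existT X i y)), n => // m /= nm.
  rewrite /ball/=; apply: (lt_le_trans (fD _ _ _ nm Dn)).
  apply: (le_trans (d_le n)); apply: ltW.
  by apply: le_lt_trans (rM n (leq_maxr _ _)); exact: ler_norm.
pose F p := if pselect (exists n, J n (projT1 p)) is left _
            then lim (f n p @[n --> \oo]) else 0.
have FD n p : D n p -> `|f n p - F p| <= d n.
  move=> Dp; have Jp : exists n, J n (projT1 p) by exists n; exact: DJ Dp.
  rewrite /F; case: pselect => // _.
  have cvg_np : (`|f n p - f m p| @[m --> \oo]) -->
      `|f n p - lim (f m p @[m --> \oo])|.
    by apply: cvg_norm; apply: cvgB; [exact: cvg_cst|exact: fcvg].
  rewrite -(cvg_lim _ cvg_np)//; apply: limr_le; first exact: cvgP cvg_np.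
  by exists n => // m /= nm; apply/ltW/fD.
exists F; split=> //; apply: baire1_sigT => i.
have [[n0 Jn0]|nJ] := pselect (exists n, J n i); last first.
  have -> : F \o existT X i = cst 0.
    by apply/funext => y; rewrite /F/=; case: pselect.
  exists (fun=> cst 0); split=> [n x|x]; exact: cvg_cst.
(* Drop the rounds before X i is met; as C i is increasing, the bounds that
   round n0 + n gives on C i (n0 + n) hold on C i n. *)
apply: (@baire1_exhaustion _ _ (C i)
  (fun n => f (n0 + n)%N \o existT X i)) => //.
- by move=> n; exact: CS.
- by move=> n; exact: baire1_existT.
- move=> n y Cy; rewrite distrC.
  apply: (le_trans (FD (n0 + n)%N _ _)).
    apply: CD; first by apply: JS Jn0; exact: leq_addr.
    by apply: CS Cy; exact: leq_addl.
  apply: (le_trans (d_le _)); rewrite exprD ler_piMl ?exprn_ge0 ?invr_ge0//.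
  by rewrite exprn_ile1 ?invr_ge0// invf_le1// ler1n.
Qed.

(** * The game *)

Theorem theorem4p2 (R : realType) (I : choiceType) (X : I -> topologicalType)
    (sigma_compactX : forall i, sigma_compact (X i))
    (tychonoffX : forall i, tychonoff_space (X i)) :
  strong_choquet (baire1_space {i : I & X i} R).
Proof.
pose Y := {i : I & X i}; pose Z := baire1_space Y R.
pose W (f : Z) (K : set Y) (e : R) :=
  [set g : Z | forall p, K p -> `|val f p - val g p| < e].
pose C i := projT1 (cid (sigma_compact_exhaustion (sigma_compactX i))).
have cC i n : compact (C i n) by rewrite /C; case: cid => /= ? [].
have CS i m n : (m <= n)%N -> C i m `<=` C i n.
  by rewrite /C; case: cid => /= ? [_ + _]; exact.
have Ccover i : \bigcup_n C i n = [set: X i].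
  by rewrite /C; case: cid => /= ? [].
have /choice[c cP] (m : Z * set Z) : exists Ke : set Y * R,
    open m.2 -> m.2 m.1 ->
    [/\ compact Ke.1, 0 < Ke.2 & W m.1 Ke.1 Ke.2 `<=` m.2].
  case: m => f U /=; have [[oU Uf]|h] := pselect (open U /\ U f).
    have /baire1_space_nbhsP[K [e KeU]] : nbhs f U by exact: open_nbhs_nbhs.
    by exists (K, e).
  by exists (set0, 0) => oU Uf; case: h.
pose hit (l : seq (Z * set Z)) : set I :=
  \big[setU/set0]_(m <- l) (@projT1 I X @` (c m).1).
pose guard (l : seq (Z * set Z)) (m : Z * set Z) : set Y :=
  (c m).1 `|` \bigcup_(i in hit l) existT X i @` C i (size l).
pose tol (l : seq (Z * set Z)) (m : Z * set Z) : R :=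
  Num.min ((c m).2 / 2) (2^-1 ^+ size l).
pose s : alpha_strategy Z := fun l =>
  if l is m0 :: l' then
    let m := last m0 l' in (W m.1 (guard l m) (tol l m))°
  else set0.
exists s => f U V.
pose mv n : Z * set Z := (f n, U n).
pose hist n := mkseq mv n.+1.
pose J n := hit (hist n).
pose D n := guard (hist n) (mv n).
pose d n := tol (hist n) (mv n).
have VE n : V n = (W (f n) (D n) (d n))°.
  rewrite /V /answer /D /d /hist mkseqS.
  by case: (mkseq mv n) => //= m0 l; rewrite last_rcons.
have JE n : J n = \bigcup_(k < n.+1) (@projT1 I X @` (c (mv k)).1).
  rewrite /J /hit /hist /mkseq big_map -/(index_iota 0 n.+1) big_mkord.
  by rewrite bigcup_mkord.
have DE n : D n = (c (mv n)).1 `|` \bigcup_(i in J n) existT X i @` C i n.+1.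
  by rewrite /D /guard /hist size_mkseq.
have dE n : d n = Num.min ((c (mv n)).2 / 2) (2^-1 ^+ n.+1).
  by rewrite /d /tol size_mkseq.
have alphaP n : (forall k, (k <= n)%N -> beta_legal f U V k) ->
    alpha_legal f U V n.
  move=> leg.
  have cmv k : (k <= n)%N -> [/\ compact (c (mv k)).1, 0 < (c (mv k)).2 &
      W (f k) (c (mv k)).1 (c (mv k)).2 `<=` U k].
    by move=> /leg[oU Uf _]; exact: (cP (mv k)).
  have [cK e0 KU] := cmv n (leqnn n).
  split; rewrite VE; first exact: open_interior.
  - apply/baire1_space_nbhsP; exists (D n), (d n); split=> //.
      rewrite DE; apply: compactU => //; apply: compact_sigT_bigcup => //.
      rewrite JE; apply: bigcup_finite; first exact: finite_II.
      by move=> k /= kn; apply: compact_sigT_finite; have [] := cmv k kn.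
    by rewrite dE lt_min divr_gt0//= exprn_gt0// invr_gt0.
  - apply: (subset_trans (@interior_subset _ _)); apply: subset_trans KU.
    move=> g gW p Kp; apply: (lt_trans (gW p _)).
      by rewrite DE; left.
    by rewrite dE gt_min; apply/orP; left; lra.
split=> // leg.
have cmv n : [/\ compact (c (mv n)).1, 0 < (c (mv n)).2 &
    W (f n) (c (mv n)).1 (c (mv n)).2 `<=` U n].
  by have [oU Uf _] := leg n; exact: (cP (mv n)).
have UV n : U n.+1 `<=` V n by have [] := leg n.+1.
have VU n : V n `<=` U n by have [] := alphaP n (fun k _ => leg k).
have fV n m : (n <= m)%N -> V n (f m).
  move=> nm; have : V m (f m) by have [] := alphaP m (fun k _ => leg k).
  move: nm => /subnKC <-; elim: (m - n)%N (f _) => [|j IHj] g.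
    by rewrite addn0.
  by rewrite addnS => /VU/UV; exact: IHj.
have [F [bF FD]] : exists F : Y -> R,
    baire1 F /\ forall n p, D n p -> `|val (f n) p - F p| <= d n.
  apply: (baire1_sigT_limit (C := C) (J := J)).
  - by move=> i; have [] := tychonoffX i.
  - exact: cC.
  - exact: CS.
  - exact: Ccover.
  - by move=> n; exact/set_mem/(valP (f n)).
  - move=> m n mn; rewrite !JE; apply: bigcup_subset => k /= km.
    exact: leq_trans mn.
  - move=> n p; rewrite DE => -[Kp|[i Ji [y _ <-]]//].
    by rewrite JE; exists n => //=; exists p.
  - move=> n i y Ji Cy; rewrite DE; right; exists i => //; exists y => //.
    by apply: CS Cy; exact: leqnSn.
  - move=> n; rewrite dE ge_min; apply/orP; right.
    by rewrite exprS ler_piMl ?exprn_ge0 ?invr_ge0// invf_le1// ler1n.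
  - move=> m n p mn Dp; have := fV m n mn; rewrite VE => /interior_subset.
    exact.
have FU n : U n (SigSub (mem_set bF) : Z).
  have [_ e0 KU] := cmv n; apply: KU => p Kp /=.
  apply: (le_lt_trans (FD n p _)); first by rewrite DE; left.
  by rewrite dE gt_min; apply/orP; left; lra.
by exists (SigSub (mem_set bF) : Z) => n _; exact/UV/FU.
Qed.
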